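(* Write $v_i^0=v_i(t_i^0)$. (i) The constrained optimal solution corresponding to the control constraint $u_i(t)-u_{max}\le 0$ with a junction point at $t=\tau_c$ may result in activating the state constraint $v_i(t)-v_{max}\le 0$ if $$t_i^m<\tau_c+\frac{3(p_i(t_i^m)-p_i(\tau_c))}{v_i^0+u_{max}\tau_c+2v_{max}}.$$ (ii) The constrained optimal solution corresponding to the control constraint $u_{min}-u_i(t)\le 0$ with a junction point at $t=\tau_c$ may result in activating the state constraint $v_{min}-v_i(t)\le 0$ if $$t_i^m>\tau_c+\frac{3(p_i(t_i^m)-p_i(\tau_c))}{v_i^0+u_{min}\tau_c+2v_{min}}.$$
   Context: A vehicle $i$ is a double integrator $\dot p_i=v_i$, $\dot v_i=u_i$, with position $p_i$, speed $v_i$ and control (acceleration) $u_i$. It enters a control zone at time $t_i^0$ and reaches the end of it at the fixed time $t_i^m>t_i^0$ (times are in $\mathbb{R}^+$). The data $t_i^0$, $p_i(t_i^0)=0$, $v_i(t_i^0)$, $t_i^m$ and $p_i(t_i^m)$ are given; the terminal speed $v_i(t_i^m)$ is not prescribed. The vehicle is to minimize $\int_{t_i^0}^{t_i^m}\tfrac12 u_i(t)^2\,dt$ subject to the dynamics, these boundary data, and the constraints $u_{min}\le u_i(t)\le u_{max}$ and $0\le v_{min}\le v_i(t)\le v_{max}$, where $u_{min},u_{max}$ are the minimum and maximum acceleration and $v_{min},v_{max}$ the minimum and maximum speed limits. The constrained optimal solution corresponding to the control constraint $u_i(t)-u_{max}\le 0$ (respectively $u_{min}-u_i(t)\le 0$)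 is the one obtained when only that constraint is taken as active. With junction point $\tau_c>t_i^0$, it consists of a constrained arc on $[t_i^0,\tau_c]$, where $u_i(t)=u_{max}$ (respectively $u_i(t)=u_{min}$), followed by an unconstrained arc on $[\tau_c,t_i^m]$, where the control is affine in $t$; position, speed and control are continuous at $\tau_c$, and the terminal costate condition for the free terminal speed gives $u_i(t_i^m)=0$. A constraint is activated by a trajectory if its bound is reached or exceeded at some time in $[t_i^0,t_i^m]$.
   Formalization: Part (ii) additionally assumes that the initial time is 0 or that the denominator v_i^0+u_min τ_c+2v_min is positive; with a positive initial time and a negative denominator the claim as written can fail. *)

(* Defs.v *)
From Stdlib Require Import Reals.
From Coquelicot Require Import Coquelicot.
Open Scope R_scope.

(* The double integrator p' = v, v' = u on [t0, tm] in integral form, so that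
   controls may be discontinuous; where u is continuous this is the
   differential equation. *)
Definition double_integrator (t0 tm : R) (p v u : R -> R) : Prop :=
  forall t, t0 <= t <= tm ->
    is_RInt u t0 t (v t - v t0) /\ is_RInt v t0 t (p t - p t0).

(* No condition is put on v tm: the terminal speed is free. *)
Definition admissible (t0 tm v0 pm : R) (p v u : R -> R) : Prop :=
  double_integrator t0 tm p v u /\ p t0 = 0 /\ v t0 = v0 /\ p tm = pm.

Definition cost (t0 tm : R) (u : R -> R) : R :=
  RInt (fun t => 1 / 2 * u t ^ 2) t0 tm.

(* g is the left-hand side of a control constraint g (u t) <= 0, the only
   inequality constraint taken into account. *)
Definition optimal_under (g : R -> R) (t0 tm v0 pm : R) (p v u : R -> R)
  : Prop :=
  admissible t0 tm v0 pm p v u /\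
  (forall t, t0 <= t <= tm -> g (u t) <= 0) /\
  forall p' v' u' : R -> R,
    admissible t0 tm v0 pm p' v' u' ->
    (forall t, t0 <= t <= tm -> g (u' t) <= 0) ->
    cost t0 tm u <= cost t0 tm u'.

(* Both arcs are closed at tauc, which makes u continuous there; p and v are
   continuous on [t0, tm] by the dynamics. The terminal costate of the free
   terminal speed vanishes, that is, u tm = 0. *)
Definition junction (ubound t0 tm tauc : R) (u : R -> R) : Prop :=
  t0 < tauc < tm /\
  (forall t, t0 <= t <= tauc -> u t = ubound) /\
  (exists a b : R, forall t, tauc <= t <= tm -> u t = a * t + b) /\
  u tm = 0.

Definition constrained_optimal_umax
    (umax t0 tm v0 pm tauc : R) (p v u : R -> R) : Prop :=
  optimal_under (fun w => w - umax) t0 tm v0 pm p v u /\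
  junction umax t0 tm tauc u.

Definition constrained_optimal_umin
    (umin t0 tm v0 pm tauc : R) (p v u : R -> R) : Prop :=
  optimal_under (fun w => umin - w) t0 tm v0 pm p v u /\
  junction umin t0 tm tauc u.

(* The constraint h t <= 0 is reached or exceeded along the trajectory. *)
Definition activates (t0 tm : R) (h : R -> R) : Prop :=
  exists t, t0 <= t <= tm /\ 0 <= h t.

(* Main.v *)
(* With T = tm - tauc and control going linearly from ubound to 0 on the last
   arc, integrating twice gives p tm - p tauc = T * (v tauc + 2 * v tm) / 3.
   Since v tauc = v0 + ubound * (tauc - t0), the hypothesis compares
   v tauc + 2 * v tm with v tauc + ubound * t0 + 2 * vbound, hence v tm with
   vbound. The sign of ubound comes from feasibility of u tm = 0. *)
Require Import Defs.
From Stdlib Require Import Reals Lra Psatz.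
From Coquelicot Require Import Coquelicot.
Open Scope R_scope.

Lemma is_RInt_quadratic (c2 c1 c0 s e : R) :
  is_RInt (fun t => c2 * t ^ 2 + c1 * t + c0) s e
    (c2 * (e ^ 3 - s ^ 3) / 3 + c1 * (e ^ 2 - s ^ 2) / 2 + c0 * (e - s)).
Proof.
  set (F := fun t => c2 * t ^ 3 / 3 + c1 * t ^ 2 / 2 + c0 * t).
  replace (_ + c0 * (e - s)) with (minus (F e) (F s))
    by (unfold F, minus, plus, opp; simpl; field).
  apply (is_RInt_derive F).
  - intros t _; unfold F; auto_derive; [trivial | field].
  - intros t _; apply (ex_derive_continuous (V := R_NormedModule)).
    auto_derive; trivial.
Qed.

(** Uniqueness of the integral turns the relations in [double_integrator] into equations for speed
    and position. *)
Lemma is_RInt_quadratic_eq (f : R -> R) (c2 c1 c0 s e l : R) :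
  s <= e -> (forall t, s <= t <= e -> f t = c2 * t ^ 2 + c1 * t + c0) ->
  is_RInt f s e l ->
  l = c2 * (e ^ 3 - s ^ 3) / 3 + c1 * (e ^ 2 - s ^ 2) / 2 + c0 * (e - s).
Proof.
  intros hse hf hl.
  rewrite <- (is_RInt_unique _ _ _ _ hl).
  rewrite (RInt_ext _ (fun t => c2 * t ^ 2 + c1 * t + c0)).
  - apply is_RInt_unique, is_RInt_quadratic.
  - rewrite Rmin_left, Rmax_right by assumption; intros t ht; apply hf; lra.
Qed.

Lemma double_integrator_sub (t0 tm s e : R) (p v u : R -> R) :
  double_integrator t0 tm p v u -> t0 <= s <= tm -> e <= tm ->
  double_integrator s e p v u.
Proof.
  intros h hs he t ht.
  assert (sub : forall f F : R -> R, is_RInt f t0 s (F s - F t0) ->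
            is_RInt f t0 t (F t - F t0) -> is_RInt f s t (F t - F s)).
  { intros f F h1 h2.
    replace (F t - F s) with (plus (opp (F s - F t0)) (F t - F t0))
      by (unfold plus, opp; simpl; ring).
    apply (is_RInt_Chasles (V := R_NormedModule) f s t0 t); [|exact h2].
    apply (is_RInt_swap (V := R_NormedModule)), h1. }
  destruct (h s) as [hvs hps]; [lra|].
  destruct (h t) as [hvt hpt]; [lra|].
  split; apply sub; assumption.
Qed.

(** Writing the increments through [u s] and [u e] eliminates [a] and [b]; the saturated arc is the
    case [a = 0]. *)
Lemma affine_control (s e a b : R) (p v u : R -> R) :
  s <= e -> double_integrator s e p v u ->
  (forall t, s <= t <= e -> u t = a * t + b) ->
  v e - v s = (e - s) * (u s + u e) / 2 /\
  p e - p s = (e - s) * v s + (e - s) ^ 2 * (2 * u s + u e) / 6.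
Proof.
  intros hse h hu.
  assert (hv : forall t, s <= t <= e ->
            v t = a / 2 * t ^ 2 + b * t + (v s - a / 2 * s ^ 2 - b * s)).
  { intros t ht; destruct (h t ht) as [ht' _].
    apply (is_RInt_quadratic_eq u 0 a b) in ht'; [lra | lra |].
    intros x hx; rewrite hu by lra; ring. }
  rewrite (hu s), (hu e) by lra; split.
  - rewrite (hv e) by lra; field.
  - destruct (h e) as [_ hp]; [lra|].
    apply (is_RInt_quadratic_eq v _ _ _ _ _ _ hse hv) in hp.
    rewrite hp; field.
Qed.

Lemma junction_speeds (ubound t0 tm tauc : R) (p v u : R -> R) :
  double_integrator t0 tm p v u -> junction ubound t0 tm tauc u ->
  v tauc = v t0 + ubound * (tauc - t0) /\
  3 * (p tm - p tauc) = (tm - tauc) * (v tauc + 2 * v tm).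
Proof.
  intros h [ht [hc [[a [b hab]] hend]]].
  destruct (affine_control t0 tauc 0 ubound p v u) as [h1 _].
  - lra.
  - apply (double_integrator_sub t0 tm); [assumption | lra | lra].
  - intros t ht'; rewrite hc by lra; ring.
  - destruct (affine_control tauc tm a b p v u) as [h2 h3].
    + lra.
    + apply (double_integrator_sub t0 tm); [assumption | lra | lra].
    + exact hab.
    + rewrite !hc in h1 by lra; rewrite hend in h2, h3.
      split; [lra|].
      (* With [u tm = 0], both increments on the last arc depend only on [v tauc] and [u tauc], so
         eliminating [u tauc] leaves the two speeds. *)
      replace (v tm) with (v tauc + (tm - tauc) * (u tauc + 0) / 2) by lra.
      rewrite h3; field.
Qed.

(* In the second part the bound has a meaning as a time only when its
   denominator is positive. For t0 = 0 the denominator is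
   v tauc + 2 * vmin and this need not be assumed. *)
Theorem theorem5
  (t0 tm v0 pm umin umax vmin vmax tauc : R) (p v u : R -> R)
  (ht0 : 0 <= t0) (htm : t0 < tm)
  (hu : umin <= umax) (hvmin : 0 <= vmin) (hv0 : vmin <= v0 <= vmax) :
  (constrained_optimal_umax umax t0 tm v0 pm tauc p v u ->
   tm < tauc + 3 * (p tm - p tauc) / (v0 + umax * tauc + 2 * vmax) ->
   activates t0 tm (fun t => v t - vmax))
  /\
  (constrained_optimal_umin umin t0 tm v0 pm tauc p v u ->
   (t0 = 0 \/ 0 < v0 + umin * tauc + 2 * vmin) ->
   tm > tauc + 3 * (p tm - p tauc) / (v0 + umin * tauc + 2 * vmin) ->
   activates t0 tm (fun t => vmin - v t)).
Proof.
  split.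
  - intros [[[hdi [_ [hv _]]] [hg _]] hj] hlt.
    destruct (junction_speeds _ _ _ _ _ _ _ hdi hj) as [hvc hp].
    destruct hj as [ht [_ [_ hend]]].
    specialize (hg tm); rewrite hend in hg.
    rewrite hp in hlt; rewrite hv in hvc.
    set (D := v0 + umax * tauc + 2 * vmax) in *.
    (* [D] equals [v tauc + umax * t0 + 2 * vmax], so by this sign [D < v tauc + 2 * v tm] forces
       [vmax < v tm]. *)
    assert (hut : 0 <= umax * t0) by nra.
    assert (hD : 0 <= D) by (unfold D; nra).
    exists tm; split; [lra|].
    destruct hD as [hD | hD].
    + assert (tm - tauc < (tm - tauc) * (v tauc + 2 * v tm) / D) by lra.
      apply Rlt_div_r in H; [|exact hD].
      apply Rmult_lt_reg_l in H; [unfold D in H; lra | lra].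
    + (* the denominator vanishes and Rocq's quotient is [0] *)
      rewrite <- hD, Rdiv_0_r in hlt; lra.
  - intros [[[hdi [_ [hv _]]] [hg _]] hj] hD hlt.
    destruct (junction_speeds _ _ _ _ _ _ _ hdi hj) as [hvc hp].
    destruct hj as [ht [_ [_ hend]]].
    specialize (hg tm); rewrite hend in hg.
    rewrite hp in hlt; rewrite hv in hvc.
    (* Clearing the denominator keeps the inequality only if it is positive; otherwise the speed is
       already at or below [vmin] at [tauc]. *)
    destruct (Rlt_or_le 0 (v0 + umin * tauc + 2 * vmin)) as [hpos | hneg].
    + set (D := v0 + umin * tauc + 2 * vmin) in *.
      (* Now [umin * t0] can only lower [D], so [v tauc + 2 * v tm < D] forces [v tm < vmin]. *)
      assert (hut : umin * t0 <= 0) by nra.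
      exists tm; split; [lra|].
      assert ((tm - tauc) * (v tauc + 2 * v tm) / D < tm - tauc) by lra.
      apply Rlt_div_l in H; [|exact hpos].
      apply Rmult_lt_reg_l in H; [unfold D in H; lra | lra].
    + (* then [t0 = 0] and [v tauc <= - 2 * vmin <= vmin] *)
      destruct hD as [-> | hD]; [|lra].
      exists tauc; split; [lra|].
      rewrite Rminus_0_r in hvc; lra.
Qed.
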